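(* Let $\xi\in\mathbb{R}^p$, $M\in\mathbb{R}^{p\times k}$, and let $\mathcal{S}=\{s\in\mathbb{R}^p: A_{\mathcal{S}}s\le b_{\mathcal{S}}\}$ be a polytope containing the origin, where $A_{\mathcal{S}}\in\mathbb{R}^{m\times p}$ has rows $a_{1,\mathcal S},\dots,a_{m,\mathcal S}\in\mathbb{R}^{1\times p}$ and $b_{\mathcal{S}}\in\mathbb{R}^m$ has entries $b_{1,\mathcal S},\dots,b_{m,\mathcal S}$. Let $q\in\{1,2\}$. For $i\in\{1,\dots,m\}$ define $\hat w^i:=\mathrm{sign}(M^\top a_{i,\mathcal S}^\top)\in\mathbb{R}^k$ (entrywise) and $w^i\in\mathbb{R}^{2k}$ by, for $j\in\{1,\dots,k\}$, $$w^i_j=\begin{cases}(M^\top a_{i,\mathcal S}^\top)_j & \text{if }\hat w^i_j=1,\\ 0&\text{otherwise,}\end{cases}\qquad w^i_{k+j}=\begin{cases}-(M^\top a_{i,\mathcal S}^\top)_j & \text{if }\hat w^i_j=-1,\\ 0&\text{otherwise.}\end{cases}$$ Then a hyper-rectangle $\mathcal{B}(l,u)\subset\mathbb{R}^k$ of maximum volume ${\rm vol}_q$ among those that contain the origin and satisfy $\xi\in\mathcal{S}\ominus M\mathcal{B}(l,u)$ is $\mathcal{B}(-\underline v^*,\overline v^* )$, where $(\underline v^*,\overline v^* )$ is an optimal solution of the convex program $$\min_{\underline v,\overline v\in\mathbb{R}^k} f_q(\overline v,\underline v)\quad\text{s.t.}\quad \big\langle w^i,[\overline v^\top\ \underline v^\top]^\top\big\rangle\le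 b_{i,\mathcal S}-a_{i,\mathcal S}\xi\ \ \forall i\in\{1,\dots,m\},\qquad \overline v\ge0,\ \underline v\ge0,$$ with $$f_1(\overline v,\underline v):=-\sum_{j=1}^k\log(\overline v_j+\underline v_j),\qquad f_2(\overline v,\underline v):=-\sum_{j=1}^k\big(\log(\overline v_j)+\log(\underline v_j)\big).$$
   Context: Vector inequalities are componentwise. A polytope is a bounded polyhedron. For $l,u\in\mathbb{R}^k$ with $l<u$, the hyper-rectangle is $\mathcal{B}(l,u):=\{x\in\mathbb{R}^k: l\le x\le u\}$. For a set $\mathcal{B}\subset\mathbb{R}^k$, $M\mathcal{B}:=\{Mz: z\in\mathcal{B}\}$, and the Pontryagin difference is $\mathcal{C}\ominus\mathcal{D}:=\{c: c+d\in\mathcal{C}\ \forall d\in\mathcal{D}\}$. For a hyper-rectangle containing the origin, written $\mathcal{B}(-\underline v,\overline v)$ with $\underline v,\overline v\ge0$, two notions of volume are used: $${\rm vol}_1(\mathcal{B}(-\underline v,\overline v)):=\prod_{j=1}^k(\overline v_j+\underline v_j),\qquad {\rm vol}_2(\mathcal{B}(-\underline v,\overline v)):=\prod_{j=1}^k\overline v_j\,\underline v_j .$$ *)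

(* Defs.v *)
From HB Require Import structures.
From mathcomp Require Import all_boot all_order all_algebra.
From mathcomp Require Import all_classical all_reals all_analysis.

Set Implicit Arguments.
Unset Strict Implicit.
Unset Printing Implicit Defensive.

Import Order.TTheory GRing.Theory Num.Theory.
Import numFieldNormedType.Exports.

Local Open Scope classical_set_scope.
Local Open Scope ring_scope.

Definition vle (R : realType) (n : nat) (x y : 'cV[R]_n) : Prop :=
  forall i, x i 0 <= y i 0.

Definition vlt (R : realType) (n : nat) (x y : 'cV[R]_n) : Prop :=
  forall i, x i 0 < y i 0.

Definition inner (R : realType) (n : nat) (x y : 'cV[R]_n) : R :=
  \sum_i x i 0 * y i 0.

Definition polyhedron (R : realType) (m p : nat)
    (A : 'M[R]_(m, p)) (b : 'cV[R]_m) : set 'cV[R]_p :=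
  [set s | vle (A *m s) b].

Definition box (R : realType) (k : nat) (l u : 'cV[R]_k) : set 'cV[R]_k :=
  [set x | vle l x /\ vle x u].

Definition pontryagin_diff (R : realType) (p : nat) (C D : set 'cV[R]_p) :
    set 'cV[R]_p :=
  [set c | forall d, D d -> C (c + d)].

(* Volumes of B(- vlo, vhi), for 0 <= vlo and 0 <= vhi. *)
Definition vol1 (R : realType) (k : nat) (vlo vhi : 'cV[R]_k) : R :=
  \prod_j (vhi j 0 + vlo j 0).

Definition vol2 (R : realType) (k : nat) (vlo vhi : 'cV[R]_k) : R :=
  \prod_j (vhi j 0 * vlo j 0).

Definition vol (q : nat) (R : realType) (k : nat) (vlo vhi : 'cV[R]_k) : R :=
  if q == 1%N then vol1 vlo vhi else vol2 vlo vhi.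

(* A pair (l, u) stands for B(l, u). If B(l, u) contains the origin then
   l <= 0 <= u; sides of length zero are not excluded here, see proper_boxes. *)
Definition admissible (R : realType) (p k : nat) (S : set 'cV[R]_p)
    (xi : 'cV[R]_p) (M : 'M[R]_(p, k)) : set ('cV[R]_k * 'cV[R]_k) :=
  [set r | box r.1 r.2 0 /\
           pontryagin_diff S [set M *m z | z in box r.1 r.2] xi].

Definition proper_boxes (R : realType) (k : nat) :
    set ('cV[R]_k * 'cV[R]_k) :=
  [set r | vlt r.1 r.2].

(* B(l, u) is B(- vlo, vhi) with vlo = - l and vhi = u. *)
Definition maximum_volume (q : nat) (R : realType) (k : nat)
    (C : set ('cV[R]_k * 'cV[R]_k)) (r : 'cV[R]_k * 'cV[R]_k) : Prop :=
  C r /\ forall r', C r' -> vol q (- r'.1) r'.2 <= vol q (- r.1) r.2.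

Definition what (R : realType) (m p k : nat) (A : 'M[R]_(m, p))
    (M : 'M[R]_(p, k)) (i : 'I_m) : 'cV[R]_k :=
  map_mx Num.sg (M^T *m (row i A)^T).

Definition w (R : realType) (m p k : nat) (A : 'M[R]_(m, p))
    (M : 'M[R]_(p, k)) (i : 'I_m) : 'cV[R]_(k + k) :=
  col_mx
    (\col_j (if what A M i j 0 == 1 then (M^T *m (row i A)^T) j 0 else 0))
    (\col_j (if what A M i j 0 == -1 then - (M^T *m (row i A)^T) j 0 else 0)).

(* The variable is v = (vlo, vhi). *)
Definition feasible (R : realType) (m p k : nat) (A : 'M[R]_(m, p))
    (b : 'cV[R]_m) (xi : 'cV[R]_p) (M : 'M[R]_(p, k)) :
    set ('cV[R]_k * 'cV[R]_k) :=
  [set v | [/\ forall i : 'I_m, inner (w A M i) (col_mx v.2 v.1)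
                                  <= b i 0 - (row i A *m xi) 0 0,
               vle 0 v.2 & vle 0 v.1]].

(* lne r%:E is ln r for 0 < r and -oo for r <= 0, so that the objectives take
   the value +oo exactly where one of the logarithms is undefined. *)
Definition f1 (R : realType) (k : nat) (vhi vlo : 'cV[R]_k) : \bar R :=
  (- \sum_j lne (vhi j 0 + vlo j 0)%R%:E)%E.

Definition f2 (R : realType) (k : nat) (vhi vlo : 'cV[R]_k) : \bar R :=
  (- \sum_j (lne (vhi j 0)%:E + lne (vlo j 0)%:E))%E.

Definition objective (q : nat) (R : realType) (k : nat)
    (v : 'cV[R]_k * 'cV[R]_k) : \bar R :=
  if q == 1%N then f1 v.2 v.1 else f2 v.2 v.1.

(* convex_function in the library is for real-valued functions only. *)
Definition convex_efunction (R : realType) (V : lmodType R)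
    (f : V -> \bar R) : Prop :=
  forall (x y : V) (t : R), 0 < t < 1 ->
    (f (t *: x + (1 - t) *: y)%R <= t%:E * f x + (1 - t)%R%:E * f y)%E.

Definition convex_program (R : realType) (V : lmodType R)
    (F : set V) (f : V -> \bar R) : Prop :=
  @convex_set R V F /\ convex_efunction f.

Definition optimal_solution (R : realType) (V : Type)
    (F : set V) (f : V -> \bar R) (v : V) : Prop :=
  F v /\ forall v', F v' -> (f v <= f v')%E.

(* Main.v *)
Require Import Defs.
From HB Require Import structures.
From mathcomp Require Import all_boot all_order all_algebra.
From mathcomp Require Import all_classical all_reals all_analysis.

Import Order.TTheory GRing.Theory Num.Theory.
Import numFieldNormedType.Exports.

Local Open Scope classical_set_scope.
Local Open Scope ring_scope.

(** The proof has two independent halves.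

    Geometry: [feasible] describes exactly the admissible boxes.  The point xi
    lies in the Pontryagin difference S - M B(l, u) iff, for every row a of A,
    the linear form z |-> <M^T a, z> is at most b_i - a xi on the whole box.
    A linear form c is maximized over a box coordinate by coordinate, at u_j
    when c_j > 0 and at l_j when c_j < 0, so that its maximum is
    sum_j (c_j^+ u_j + c_j^- (- l_j)), which is the inner product of w with
    (u, - l) ([box_support]).  Hence B(l, u) is admissible iff (- l, u) is
    feasible ([admissibleP]).

    Analysis: both objectives have the form [neglog] (g v), where g is linear
    in v and nonnegative on the feasible set, and the volume is the product of
    the entries of g v: take g v = vhi + vlo for vol_1, and let g v stack vhi
    on top of vlo for vol_2 ([objective_factors]).  Convexity is then the
    concavity of the logarithm, and the volume is exp (- f) ([expeR_neglog]).
    Since exp is increasing, minimizing f and maximizing the volume are the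
    same problem.  With exp (-oo) = 0 this includes the degenerate boxes, of
    volume 0 and objective +oo. *)

(** * Maximizing a linear form over a box *)

Lemma innerDZr (R : realType) (n : nat) (a x y : 'cV[R]_n) (s t : R) :
  inner a (s *: x + t *: y) = s * inner a x + t * inner a y.
Proof.
rewrite /inner !mulr_sumr -big_split; apply: eq_bigr => j _ /=.
by rewrite !mxE mulrDr mulrCA; congr (_ + _); rewrite mulrCA.
Qed.

Lemma row_mulmxE (R : realType) (m p k : nat) (A : 'M[R]_(m, p))
    (M : 'M[R]_(p, k)) (i : 'I_m) (z : 'cV[R]_k) :
  (A *m (M *m z)) i 0 = inner (M^T *m (row i A)^T) z.
Proof.
rewrite mulmxA mxE; apply: eq_bigr => j _; congr (_ * _).
by rewrite -trmx_mul !mxE; apply: eq_bigr => h _; rewrite mxE.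
Qed.

Lemma inner_wE (R : realType) (m p k : nat) (A : 'M[R]_(m, p))
    (M : 'M[R]_(p, k)) (i : 'I_m) (vhi vlo : 'cV[R]_k) :
  let c := M^T *m (row i A)^T in
  inner (w A M i) (col_mx vhi vlo) =
  \sum_j ((if 0 < c j 0 then c j 0 else 0) * vhi j 0 +
          (if c j 0 < 0 then - c j 0 else 0) * vlo j 0).
Proof.
move=> c; rewrite /inner big_split_ord /= -big_split; apply: eq_bigr => j _ /=.
by rewrite /w !col_mxEu !col_mxEd !mxE -/c !sgr_cp0.
Qed.

(** The maximum of the linear form is attained at the vertex of the box that
    takes, in each coordinate, the end selected by the sign of the
    coefficient; this makes the single inequality on the right necessary. *)
Lemma box_support (R : realType) (m p k : nat) (A : 'M[R]_(m, p))
    (M : 'M[R]_(p, k)) (i : 'I_m) (l u : 'cV[R]_k) (r : R) : vle l u ->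
  (forall z, box l u z -> inner (M^T *m (row i A)^T) z <= r) <->
  inner (w A M i) (col_mx u (- l)) <= r.
Proof.
move=> lu; rewrite inner_wE; set c := M^T *m _; split=> [boxr | wr z [lz zu]].
  set z : 'cV[R]_k := \col_j (if 0 < c j 0 then u j 0 else l j 0).
  have /boxr : box l u z.
    by split=> j; rewrite mxE; case: ifP => // _; apply: lu.
  apply: le_trans; apply: ler_sum => j _; rewrite !mxE.
  by case: ltgtP => [||<-]; rewrite !(mul0r, add0r, addr0, mulrNN).
apply: le_trans wr; apply: ler_sum => j _; rewrite [(- l) j 0]mxE.
have [c0|c0|->] := ltgtP (c j 0) 0; rewrite !(mul0r, add0r, addr0)//.
- by rewrite mulrNN ler_nM2l.
- by rewrite ler_pM2l.
Qed.

(** * Admissible boxes are the feasible points *)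

Lemma admissibleP (R : realType) (m p k : nat) (A : 'M[R]_(m, p))
    (b : 'cV[R]_m) (xi : 'cV[R]_p) (M : 'M[R]_(p, k)) (l u : 'cV[R]_k) :
  admissible (polyhedron A b) xi M (l, u) <-> feasible A b xi M (- l, u).
Proof.
have bndE i z : ((A *m (xi + M *m z)) i 0 <= b i 0) =
    (inner (M^T *m (row i A)^T) z <= b i 0 - (row i A *m xi) 0 0).
  by rewrite mulmxDr mxE row_mulmxE -row_mul [row _ _ _ _]mxE lerBrDl.
split=> [[/= [l0 u0] xiS] | [/= wr u0 l0]].
  have lu : vle l u by move=> j; apply: le_trans (l0 j) (u0 j).
  split=> [i | // | j]; last by have := l0 j; rewrite !mxE oppr_ge0.
  apply/(box_support _ _ _ _ A M i l u _ lu) => z zB; rewrite -bndE.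
  by apply: xiS; exists z.
have {}l0 : vle l 0 by move=> j; have := l0 j; rewrite !mxE oppr_ge0.
have lu : vle l u by move=> j; apply: le_trans (l0 j) (u0 j).
split=> //= _ [z zB <-] i; rewrite bndE.
by move: z zB; apply/(box_support _ _ _ _ A M i l u _ lu)/wr.
Qed.

Lemma feasible_convex (R : realType) (m p k : nat) (A : 'M[R]_(m, p))
    (b : 'cV[R]_m) (xi : 'cV[R]_p) (M : 'M[R]_(p, k)) :
  convex_set (feasible A b xi M).
Proof.
move=> x y t /set_mem[xw x2 x1] /set_mem[yw y2 y1]; apply: mem_set.
have t0 : 0 <= t%:num by [].
have t1 : 0 <= (1 - t%:num) by rewrite subr_ge0.
have conv_le (a c d : R) : a <= d -> c <= d ->
    t%:num * a + (1 - t%:num) * c <= d.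
  move=> ad cd; apply: le_trans (lerD (ler_wpM2l t0 ad) (ler_wpM2l t1 cd)) _.
  by rewrite -mulrDl addrC subrK mul1r.
have conv_ge0 (a c : 'cV[R]_k) : vle 0 a -> vle 0 c ->
    vle 0 (t%:num *: a + (1 - t%:num) *: c).
  by move=> a0 c0 j; rewrite !mxE addr_ge0// mulr_ge0//;
     [have := a0 j | have := c0 j]; rewrite mxE.
split=> [i | | ]; [ | exact: conv_ge0 | exact: conv_ge0].
by rewrite /= -add_col_mx -!scale_col_mx innerDZr; apply: conv_le.
Qed.

(** * The negative logarithm of a product *)

Definition neglog {R : realType} {n : nat} (x : 'cV[R]_n) : \bar R :=
  (- \sum_j lne (x j 0)%:E)%E.

Lemma lne_real_lty (R : realType) (r : R) : (lne r%:E < +oo)%E.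
Proof. by rewrite /=; case: ifP => _; rewrite ?ltry. Qed.

(** No term is -oo, so the minus sign can be moved inside the sum. *)
Lemma neglogE (R : realType) (n : nat) (x : 'cV[R]_n) :
  neglog x = (\sum_j - lne (x j 0)%:E)%E.
Proof.
rewrite /neglog -sumeN// => i j _ _.
by apply: ltpinfty_adde_def; apply: lne_real_lty.
Qed.

Lemma neglog_lty (R : realType) (n : nat) (x : 'cV[R]_n) :
  (neglog x < +oo)%E -> vlt 0 x.
Proof.
move=> fx j; rewrite mxE ltNge; apply/negP => xj0; move: fx.
suff -> : neglog x = +oo%E by rewrite ltxx.
apply/eqP; rewrite neglogE esum_eqy.
  by apply/existsP; exists j; rewrite le0_lneNy.
by move=> i _; rewrite -ltNye lteNr; apply: lne_real_lty.
Qed.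

(** On [\bar R], [expeR] takes sums to products without any finiteness
    condition, because exp (-oo) = 0 absorbs every factor, and it inverts [lne] on the nonnegative reals, 0 included. *)
Lemma expeR_neglog (R : realType) (n : nat) (x : 'cV[R]_n) : vle 0 x ->
  expeR (- neglog x) = (\prod_j x j 0)%:E.
Proof.
move=> x0; rewrite oppeK (big_morph expeR (@expeRD R) (@expeR0 R)) -prodEFin.
apply: eq_bigr => j _; apply/eqP; rewrite lneK_eq lee_fin.
by have := x0 j; rewrite mxE.
Qed.

(** If x or y is nonpositive, the right-hand side is +oo: the weights are
    positive and - lne never takes the value -oo on a real argument, so that
    no indeterminate sum arises.  Otherwise this is concavity of ln. *)
Lemma lne_concave (R : realType) (x y t : R) : 0 < t < 1 ->
  (- lne (t * x + (1 - t) * y)%R%:E <=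
   t%:E * - lne x%:E + (1 - t)%:E * - lne y%:E)%E.
Proof.
move=> /andP[t0 t1]; have s0 : 0 < 1 - t by rewrite subr_gt0.
have [x0|x0] := leP x 0.
  rewrite [lne x%:E]le0_lneNy// gt0_muley ?lte_fin// addye ?leey//.
  by rewrite /=; case: ifP => _; rewrite ?gt0_muley ?lte_fin.
have [y0|y0] := leP y 0.
  by rewrite [lne y%:E]le0_lneNy// gt0_muley ?lte_fin// lne_EFin// addey ?leey.
rewrite !lne_EFin ?addr_gt0 ?mulr_gt0// -!EFinN -!EFinM -EFinD lee_fin.
rewrite !mulrN -opprD lerN2.
exact: (@concave_ln R (Itv01 (ltW t0) (ltW t1)) x y x0 y0).
Qed.

Lemma neglog_convex (R : realType) (n : nat) :
  convex_efunction (@neglog R n).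
Proof.
move=> x y t t01.
have def_sum (z : 'cV[R]_n) (i j : 'I_n) :
    ((- lne (z i 0)%:E) +? (- lne (z j 0)%:E))%E.
  by rewrite adde_defNN; apply: ltpinfty_adde_def; apply: lne_real_lty.
rewrite !neglogE !fin_num_sume_distrr; do ?[by []|by move=> i j _ _].
rewrite -big_split.
by apply: lee_sum => j _; rewrite !mxE; apply: lne_concave.
Qed.

(** * Volumes as products *)

(** Treats both volumes at once: the entries of g v are the quantities whose
    logarithms the objective adds up.  Being linear, g transports the
    convexity of [neglog] to the objective.  The last clause serves the strict
    condition l < u: a finite objective makes every entry of g v positive. *)
Lemma objective_factors (q : nat) (R : realType) (k : nat) :
  q = 1%N \/ q = 2%N ->
  exists (n : nat) (g : 'cV[R]_k * 'cV[R]_k -> 'cV[R]_n),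
  [/\ forall a c x y, g (a *: x + c *: y) = a *: g x + c *: g y,
      forall v, objective q v = neglog (g v),
      forall vlo vhi, vol q vlo vhi = \prod_j g (vlo, vhi) j 0 &
      forall vlo vhi, vle 0 vlo -> vle 0 vhi ->
        vle 0 (g (vlo, vhi)) /\
        (vlt 0 (g (vlo, vhi)) -> vlt (- vlo) vhi)].
Proof.
move=> [->|->].
  exists k, (fun v => v.2 + v.1); split=> [a c x y | v | vlo vhi | vlo vhi lo hi].
  - by rewrite /= !scalerDr addrACA.
  - rewrite /objective /f1 /neglog /=.
    by congr (- _)%E; apply: eq_bigr => j _; rewrite mxE.
  - by rewrite /vol /vol1 /=; apply: eq_bigr => j _; rewrite mxE.
  - split=> [j | pos j].
      by have := lo j; have := hi j; rewrite !mxE => ? ?; rewrite addr_ge0.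
    by have := pos j; rewrite !mxE => ?; rewrite -subr_gt0 opprK.
exists (k + k)%N, (fun v => col_mx v.2 v.1).
split=> [a c x y | v | vlo vhi | vlo vhi lo hi].
- by rewrite !scale_col_mx add_col_mx.
- rewrite /objective /f2 /neglog /= big_split_ord /= -big_split.
  by congr (- _)%E; apply: eq_bigr => j _; rewrite col_mxEu col_mxEd.
- rewrite /vol /vol2 /= big_split_ord /= -big_split.
  by apply: eq_bigr => j _; rewrite col_mxEu col_mxEd.
- split=> [j | pos j].
    by case: (split_ordP j) => h ->; rewrite ?col_mxEu ?col_mxEd mxE;
       [have := hi h | have := lo h]; rewrite mxE.
  have := pos (lshift k j); have := pos (rshift k j).
  rewrite col_mxEu col_mxEd !mxE => lo0 hi0.
  by apply: lt_trans hi0; rewrite oppr_lt0.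
Qed.

Theorem theorem4p4 (R : realType) (m p k : nat)
    (xi : 'cV[R]_p) (M : 'M[R]_(p, k)) (A : 'M[R]_(m, p)) (b : 'cV[R]_m)
    (bounded_S : bounded_set (polyhedron A b))
    (origin_S : polyhedron A b 0)
    (q : nat) (hq : q = 1%N \/ q = 2%N) :
  convex_program (feasible A b xi M) (@objective q R k) /\
  forall vlo vhi : 'cV[R]_k,
    optimal_solution (feasible A b xi M) (@objective q R k) (vlo, vhi) ->
    ((objective q (vlo, vhi) < +oo)%E ->
      maximum_volume q
        (admissible (polyhedron A b) xi M `&` @proper_boxes R k)
        (- vlo, vhi)) /\
    maximum_volume q (admissible (polyhedron A b) xi M) (- vlo, vhi).
Proof.
have [n [g [g_lin objE volE g_pos]]] := @objective_factors q R k hq.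
split.
  split; first exact: feasible_convex.
  by move=> x y t t01; rewrite !objE g_lin; apply: neglog_convex.
move=> vlo vhi [vF vopt].
have expE lo hi : feasible A b xi M (lo, hi) ->
    expeR (- objective q (lo, hi)) = (vol q lo hi)%:E.
  by case=> _ /= hi0 lo0; rewrite objE volE expeR_neglog//; case: (g_pos lo hi).
have adm : admissible (polyhedron A b) xi M (- vlo, vhi).
  by apply/admissibleP; rewrite opprK.
have volmax r : admissible (polyhedron A b) xi M r ->
    vol q (- r.1) r.2 <= vol q (- - vlo) vhi.
  case: r => l u /admissibleP rF; rewrite opprK -lee_fin -!expE//.
  by rewrite lee_expeR leeN2; apply: vopt.
split=> [fin | ]; last by split.
split=> [ | r [/volmax//]]; split=> //.
have [_ /= hi0 lo0] := vF; have [_] := g_pos vlo vhi lo0 hi0.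
by apply; apply: neglog_lty; rewrite -objE.
Qed.
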